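(* Let $w\in\bar{\mathcal L}_2$ be the true disturbance, let $\bar w\in\mathcal L_2$ be a (possibly inaccurate) prediction of it, and let $\Delta\bar w:=w-\bar w$. Consider the certainty equivalent (CE) optimistic controller $$u_t^{\mathrm{CE}}=-Kx_t-(R+B^\top PB)^{-1}B^\top\sum_{i=0}^\infty(F^\top)^iP\bar w_{t+i},\qquad t\ge0.$$ Then it attains infinite-horizon dynamic regret that is upper bounded by $$\mathcal R(\mathrm{CE},w)\;\le\;\|\Delta\bar w\|^2\,\|H\|\,\|P\|^2\,\frac{c^2}{(1-\lambda)^2},$$ where $\lambda=\frac{1+\rho(F)}2<1$ and $c>1$ is a constant such that $\|F^i\|\le c\lambda^i$ and $\|(F^\infty)^i\|\le c(\lambda^\infty)^i$ for all $i\ge1$, with $\lambda^\infty=\frac{1+\rho(F^\infty)}2$ and $F^\infty$ the closed-loop matrix of the infinite-horizon $\mathcal H_\infty$ controller.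
   Context: System and cost. $x_{t+1}=Ax_t+Bu_t+w_t$, with $x_t,w_t\in\mathbb R^n$, $u_t\in\mathbb R^m$, $A\in\mathbb R^{n\times n}$, $B\in\mathbb R^{n\times m}$ known, initial state $x_0\in\mathbb R^n$ with $\|x_0\|\le X$ for a given $X>0$. Cost matrices $Q,Q_T\succeq0$ in $\mathbb R^{n\times n}$ (where $Q_T$ is the terminal weight) and $R\succ0$ in $\mathbb R^{m\times m}$; $(A,Q)$ is detectable and $(A,B)$ is stabilizable. $J^T(u,w;x_0)=x_T^\top Q_Tx_T+\sum_{t=0}^{T-1}(x_t^\top Qx_t+u_t^\top Ru_t)$ and $J(u,w;x_0)=\lim_{T\to\infty}J^T(u,w;x_0)$. For sequences $w=(w_t)_{t\ge0}$ in $\mathbb R^n$, $\|w\|=(\sum_t\|w_t\|^2)^{1/2}$; $\mathcal L_2$ is the set of sequences with $\|w\|<\infty$ and $\bar{\mathcal L}_2$ the set of those with $\|w\|\le1$. For matrices $\|\cdot\|$ is the spectral norm and $\rho(\cdot)$ the spectral radius. LQR quantities. $P$ is the (stabilizing) solution of the discrete algebraic Riccati equation $P=Q+A^\top PA-A^\top PB(R+B^\top PB)^{-1}B^\top PA$, $K=(R+B^\top PB)^{-1}B^\top PA$, $F=A-BK$ (so $\rho(F)<1$), and $H:=B(R+B^\top PB)^{-1}B^\top$. $\mathcal H_\infty$ closed-loop matrix (enters only through the choice of $c$). For $\gamma>0$ let $M(\gamma)$, with $\Lambda(\gamma)$, be the minimal non-negative-definite stationary solution of $\Lambda=I+(BR^{-1}B^\top-\gamma^{-2}I)M$,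 $M=Q+A^\top M\Lambda^{-1}A$. Let $w_t^\star(\gamma)=\gamma^{-2}M(\gamma)\Lambda^{-1}(\gamma)Ax_t^\infty$ with $x_{t+1}^\infty=\Lambda^{-1}(\gamma)Ax_t^\infty$, $x_0^\infty=x_0$, $t\ge0$, and let $\bar\gamma$ be the value of $\gamma$ for which $\|w^\star(\bar\gamma)\|=1$ (with the minimax problem well-posed; initial states for which such a $\bar\gamma$ exists are considered). The infinite-horizon $\mathcal H_\infty$ controller is $u_t^\infty=-K^\infty x_t$, $K^\infty=R^{-1}B^\top M(\bar\gamma)\Lambda^{-1}(\bar\gamma)A$, and $F^\infty=A-BK^\infty$, which satisfies $\rho(F^\infty)<1$. A constant $c$ as in the claim exists by Gelfand's formula. Regret. The optimal offline input $u^\star$ minimizes $J(u,w;x_0)$ with full knowledge of $w$ and without restriction to a policy class; it is given by $u_t^\star=-Kx_t-(R+B^\top PB)^{-1}B^\top\sum_{i=0}^\infty(F^\top)^iPw_{t+i}$. The CE controller acts optimally for the system driven by the prediction, $x_{t+1}=Ax_t+Bu_t+\bar w_t$, i.e. it is the same law with $w$ replaced by $\bar w$. The dynamic regret is $\mathcal R(\mathrm{CE},w)=J(u^{\mathrm{CE}},w;x_0)-J(u^\star,w;x_0)$, where both costs are evaluated along the true system driven by $w$ from the same $x_0$. *)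

(* Defs.v *)
From HB Require Import structures.
From mathcomp Require Import all_boot all_order all_algebra.
From mathcomp Require Import all_classical all_reals all_analysis.
From mathcomp Require Import complex.

Set Implicit Arguments.
Unset Strict Implicit.
Unset Printing Implicit Defensive.

Import Order.TTheory GRing.Theory Num.Theory.
Import numFieldNormedType.Exports.

Local Open Scope classical_set_scope.
Local Open Scope ring_scope.

(* The library norm [`| v |] on matrices is the sup norm, whence this
   Euclidean norm. *)
Definition enorm (R : realType) (n : nat) (v : 'cV[R]_n) : R :=
  Num.sqrt (\sum_(i < n) v i 0 ^+ 2).

Definition spectral_norm (R : realType) (m n : nat) (M : 'M[R]_(m, n)) : R :=
  sup [set enorm (M *m v) | v in [set v : 'cV[R]_n | enorm v <= 1]].

Definition spectral_radius (R : realType) (n : nat) (M : 'M[R]_n) : R :=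
  sup [set ComplexField.Normc.normc z | z in
        [set z : R[i] | eigenvalue (map_mx (real_complex R) M) z]].

Definition qform (R : realType) (n : nat) (M : 'M[R]_n) (v : 'cV[R]_n) : R :=
  (v^T *m M *m v) 0 0.

Definition psd (R : realType) (n : nat) (M : 'M[R]_n) : Prop :=
  M^T = M /\ forall v : 'cV[R]_n, 0 <= qform M v.

Definition pd (R : realType) (n : nat) (M : 'M[R]_n) : Prop :=
  M^T = M /\ forall v : 'cV[R]_n, v != 0 -> 0 < qform M v.

Definition stabilizable (R : realType) (n m : nat)
    (A : 'M[R]_n) (B : 'M[R]_(n, m)) : Prop :=
  exists G : 'M[R]_(m, n), spectral_radius (A - B *m G) < 1.

Definition detectable (R : realType) (n p : nat)
    (A : 'M[R]_n) (C : 'M[R]_(p, n)) : Prop :=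
  exists L : 'M[R]_(n, p), spectral_radius (A - L *m C) < 1.

(* The l2 norm of a sequence is an extended real: [+oo] off L2. *)
Definition l2norm (R : realType) (n : nat) (w : nat -> 'cV[R]_n) : \bar R :=
  sqrte (\sum_(0 <= t <oo) (enorm (w t) ^+ 2)%:E)%E.

Definition L2 (R : realType) (n : nat) : set (nat -> 'cV[R]_n) :=
  [set w | (l2norm w < +oo)%E].

Definition L2_unit_ball (R : realType) (n : nat) : set (nat -> 'cV[R]_n) :=
  [set w | (l2norm w <= 1)%E].

Section LinearQuadraticControl.
Variables (R : realType) (n m : nat).
Variables (A : 'M[R]_n) (B : 'M[R]_(n, m)).
(* [Rc] is the input weight; [R] is the field of reals. *)
Variables (Q QT : 'M[R]_n) (Rc : 'M[R]_m).

Fixpoint state (u : nat -> 'cV[R]_m) (w : nat -> 'cV[R]_n) (x0 : 'cV[R]_n)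
    (t : nat) : 'cV[R]_n :=
  if t is s.+1 then A *m state u w x0 s + B *m u s + w s else x0.

Definition cost_upto (u : nat -> 'cV[R]_m) (w : nat -> 'cV[R]_n)
    (x0 : 'cV[R]_n) (T : nat) : R :=
  qform QT (state u w x0 T)
  + \sum_(0 <= t < T) (qform Q (state u w x0 t) + qform Rc (u t)).

(* Inputs of infinite cost compete in the minimization, so the limit is taken
   in [\bar R].  For [w] in L2 and detectable [(A, Q)] it exists for every [u]:
   the running cost is nondecreasing, and if it is bounded then the state
   tends to 0, so the terminal cost vanishes. *)
Definition cost (u : nat -> 'cV[R]_m) (w : nat -> 'cV[R]_n)
    (x0 : 'cV[R]_n) : \bar R :=
  limn (fun T => (cost_upto u w x0 T)%:E).

Fixpoint policy_state (mu : nat -> 'cV[R]_n -> 'cV[R]_m)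
    (w : nat -> 'cV[R]_n) (x0 : 'cV[R]_n) (t : nat) : 'cV[R]_n :=
  if t is s.+1 then
    let x := policy_state mu w x0 s in A *m x + B *m mu s x + w s
  else x0.

Definition policy_input (mu : nat -> 'cV[R]_n -> 'cV[R]_m)
    (w : nat -> 'cV[R]_n) (x0 : 'cV[R]_n) (t : nat) : 'cV[R]_m :=
  mu t (policy_state mu w x0 t).

Definition offline_optimal (w : nat -> 'cV[R]_n) (x0 : 'cV[R]_n)
    (ustar : nat -> 'cV[R]_m) : Prop :=
  forall u : nat -> 'cV[R]_m, (cost ustar w x0 <= cost u w x0)%E.

Definition dynamic_regret (u ustar : nat -> 'cV[R]_m) (w : nat -> 'cV[R]_n)
    (x0 : 'cV[R]_n) : \bar R :=
  (cost u w x0 - cost ustar w x0)%E.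

Section RiccatiQuantities.
Variable P : 'M[R]_n.

Definition input_hessian : 'M[R]_m := Rc + B^T *m P *m B.

Definition lqr_gain : 'M[R]_(m, n) :=
  invmx input_hessian *m B^T *m P *m A.

Definition lqr_closed_loop : 'M[R]_n := A - B *m lqr_gain.

Definition lqr_H : 'M[R]_n := B *m invmx input_hessian *m B^T.

Definition stabilizing_dare_solution : Prop :=
  [/\ psd P,
      P = Q + A^T *m P *m A
          - A^T *m P *m B *m invmx input_hessian *m B^T *m P *m A
    & spectral_radius lqr_closed_loop < 1].

(* The certainty equivalent policy for the prediction [wbar]; the limit is that
   of the partial sums of the vector series. *)
Definition ce_policy (wbar : nat -> 'cV[R]_n) (t : nat) (x : 'cV[R]_n) :
    'cV[R]_m :=
  - (lqr_gain *m x)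
  - invmx input_hessian *m B^T *m
    limn (fun N => \sum_(0 <= i < N)
                     (lqr_closed_loop^T ^+ i *m P *m wbar (t + i)%N)).

Definition ce_input (wbar w : nat -> 'cV[R]_n) (x0 : 'cV[R]_n) :
    nat -> 'cV[R]_m :=
  policy_input (ce_policy wbar) w x0.

End RiccatiQuantities.

Section HInfinity.
Variable gamma : R.

Definition hinf_solution (M Lambda : 'M[R]_n) : Prop :=
  [/\ psd M,
      Lambda \in unitmx,
      Lambda = 1%:M + (B *m invmx Rc *m B^T - (gamma ^- 2)%:M) *m M
    & M = Q + A^T *m M *m invmx Lambda *m A].

(* Minimality is for the Loewner order. *)
Definition minimal_hinf_solution (M Lambda : 'M[R]_n) : Prop :=
  hinf_solution M Lambda /\
  forall M' Lambda' : 'M[R]_n, hinf_solution M' Lambda' -> psd (M' - M).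

Definition hinf_state (Lambda : 'M[R]_n) (x0 : 'cV[R]_n) (t : nat) :
    'cV[R]_n :=
  iter t (fun x => invmx Lambda *m A *m x) x0.

Definition hinf_disturbance (M Lambda : 'M[R]_n) (x0 : 'cV[R]_n) (t : nat) :
    'cV[R]_n :=
  gamma ^- 2 *: (M *m invmx Lambda *m A *m hinf_state Lambda x0 t).

Definition hinf_gain (M Lambda : 'M[R]_n) : 'M[R]_(m, n) :=
  invmx Rc *m B^T *m M *m invmx Lambda *m A.

Definition hinf_closed_loop (M Lambda : 'M[R]_n) : 'M[R]_n :=
  A - B *m hinf_gain M Lambda.

(* Well-posedness: the game with payoff [J(u, w) - gamma^2 |w|^2] has a finite
   upper value, i.e. some state-feedback policy keeps the payoff bounded
   over all disturbances in L2. *)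
Definition minimax_well_posed (x0 : 'cV[R]_n) : Prop :=
  exists (mu : nat -> 'cV[R]_n -> 'cV[R]_m) (b : R),
    forall w : nat -> 'cV[R]_n, L2 w ->
      (cost (policy_input mu w x0) w x0
         <= b%:E + (gamma ^+ 2)%:E * l2norm w ^+ 2)%E.

End HInfinity.

End LinearQuadraticControl.

(* Main.v *)
(* With [v_t = P w_t + F^T v_(t+1)], completing the square along the Riccati
    equation rewrites the cost of every input [u] as a constant independent of
    [u], plus a terminal term, plus the sum of the [S]-energies of
    [u_t + K x_t + S^-1 B^T v_t], where [S = R + B^T P B].  The terminal term
    vanishes as soon as the state does: for the CE input because [F] is stable,
    for an optimal input because its cost is finite and [(A, Q)] is detectable.
    Hence the regret is at most the sum of [dv_t^T H dv_t], where [dv] is [v]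
    computed from [w - wbar], and [dv] is obtained from [w - wbar] by a filter
    with geometrically decaying coefficients, which Young's inequality bounds. *)
Require Import Defs.
From mathcomp Require Import all_boot all_order all_algebra.
From mathcomp Require Import all_classical all_reals all_analysis.
From mathcomp Require Import complex ring lra.
Import Order.TTheory GRing.Theory Num.Theory.
Import numFieldNormedType.Exports.
Set Implicit Arguments.
Unset Strict Implicit.
Unset Printing Implicit Defensive.
Local Open Scope classical_set_scope.
Local Open Scope ring_scope.

(** * Euclidean inner product, semidefinite forms and spectral norm *)

Section EuclideanSpace.
Variable R : realType.
Implicit Types n m : nat.

Definition vdot n (u v : 'cV[R]_n) : R := (u^T *m v) 0 0.

Lemma vdotE n (u v : 'cV[R]_n) : vdot u v = \sum_i u i 0 * v i 0.
Proof. by rewrite /vdot mxE; apply: eq_bigr => i _; rewrite mxE. Qed.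

Lemma vdotC n (u v : 'cV[R]_n) : vdot u v = vdot v u.
Proof. by rewrite !vdotE; apply: eq_bigr => i _; rewrite mulrC. Qed.

Lemma vdotDr n (u v1 v2 : 'cV[R]_n) : vdot u (v1 + v2) = vdot u v1 + vdot u v2.
Proof. by rewrite /vdot mulmxDr mxE. Qed.

Lemma vdotDl n (u1 u2 v : 'cV[R]_n) : vdot (u1 + u2) v = vdot u1 v + vdot u2 v.
Proof. by rewrite vdotC vdotDr !(vdotC v). Qed.

Lemma vdotNr n (u v : 'cV[R]_n) : vdot u (- v) = - vdot u v.
Proof. by rewrite /vdot mulmxN mxE. Qed.

Lemma vdotNl n (u v : 'cV[R]_n) : vdot (- u) v = - vdot u v.
Proof. by rewrite vdotC vdotNr vdotC. Qed.

Lemma vdotZr n a (u v : 'cV[R]_n) : vdot u (a *: v) = a * vdot u v.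
Proof. by rewrite /vdot -scalemxAr mxE. Qed.

Lemma vdotZl n a (u v : 'cV[R]_n) : vdot (a *: u) v = a * vdot u v.
Proof. by rewrite vdotC vdotZr vdotC. Qed.

Lemma vdot_mulmx n m (M : 'M[R]_(m, n)) (u : 'cV[R]_n) (v : 'cV[R]_m) :
  vdot (M *m u) v = vdot u (M^T *m v).
Proof. by rewrite /vdot trmx_mul mulmxA. Qed.

Lemma qform_vdot n (M : 'M[R]_n) v : qform M v = vdot v (M *m v).
Proof. by rewrite /qform /vdot mulmxA. Qed.

Lemma enorm_ge0 n (v : 'cV[R]_n) : 0 <= enorm v.
Proof. exact: sqrtr_ge0. Qed.

Lemma enorm_sqr n (v : 'cV[R]_n) : enorm v ^+ 2 = vdot v v.
Proof.
by rewrite sqr_sqrtr ?vdotE//; apply: sumr_ge0 => i _; rewrite sqr_ge0.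
Qed.

Lemma vdot_ge0 n (v : 'cV[R]_n) : 0 <= vdot v v.
Proof. by rewrite -enorm_sqr sqr_ge0. Qed.

Lemma enorm_eq0 n (v : 'cV[R]_n) : (enorm v == 0) = (v == 0).
Proof.
apply/idP/eqP => [|->]; last first.
  by rewrite -sqrf_eq0 enorm_sqr /vdot mulmx0 mxE.
rewrite -sqrf_eq0 enorm_sqr vdotE psumr_eq0; last first.
  by move=> i _; rewrite -expr2 sqr_ge0.
move=> /allP v0; apply/colP => i; rewrite mxE.
by have := v0 i (mem_index_enum i); rewrite /= mulf_eq0 orbb => /eqP.
Qed.

Lemma enorm0 n : enorm (0 : 'cV[R]_n) = 0.
Proof. by apply/eqP; rewrite enorm_eq0. Qed.

Lemma enormN n (v : 'cV[R]_n) : enorm (- v) = enorm v.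
Proof. by rewrite /enorm; under eq_bigr do rewrite mxE sqrrN. Qed.

Lemma enormZ n a (v : 'cV[R]_n) : enorm (a *: v) = `|a| * enorm v.
Proof.
rewrite /enorm -sqrtr_sqr -sqrtrM ?sqr_ge0// mulr_sumr.
by under eq_bigr do rewrite mxE exprMn.
Qed.

(** The form is nonnegative at [u - s *: v] for every [s]; the choice [s = b / d], the minimizer
    when [d] is nonzero, gives the claim. *)
Lemma psd_cauchy_schwarz n (M : 'M[R]_n) (u v : 'cV[R]_n) : psd M ->
  vdot u (M *m v) ^+ 2 <= qform M u * qform M v.
Proof.
move=> [MT M0].
have quad s : 0 <= qform M u - 2 * s * vdot u (M *m v) + s ^+ 2 * qform M v.
  have := M0 (u - s *: v); rewrite !qform_vdot mulmxDr mulmxN -scalemxAr.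
  rewrite !(vdotDl, vdotDr, vdotNl, vdotNr, vdotZl, vdotZr).
  rewrite (vdotC v (M *m u)) vdot_mulmx MT => h.
  by apply: le_trans h _; rewrite le_eqVlt; apply/orP; left; apply/eqP; ring.
set a := qform M u in quad *; set b := vdot _ _ in quad *.
set d := qform M v in quad *.
have a0 : 0 <= a by exact: M0.
have d0 : 0 <= d by exact: M0.
(* [M] is only semidefinite, so [d] may vanish. The quadratic is then affine in [s], and a nonzero
   [b] would let it take the value -1. *)
have [d_eq0|d_neq0] := eqVneq d 0.
  have [->|b_neq0] := eqVneq b 0; first by rewrite expr0n mulr_ge0.
  have := quad ((a + 1) / (2 * b)); rewrite d_eq0 mulr0 addr0.
  have -> : 2 * ((a + 1) / (2 * b)) * b = a + 1 by field.
  lra.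
have := quad (b / d).
have -> : a - 2 * (b / d) * b + (b / d) ^+ 2 * d = (a * d - b ^+ 2) / d by field.
have d_gt0 : 0 < d by rewrite lt_neqAle eq_sym d_neq0.
by rewrite pmulr_lge0 ?invr_gt0// subr_ge0.
Qed.

Lemma psd1 n : psd (1%:M : 'M[R]_n).
Proof.
by split=> [|v]; rewrite ?trmx1// qform_vdot mul1mx vdot_ge0.
Qed.

Lemma vdot_le n (u v : 'cV[R]_n) : `|vdot u v| <= enorm u * enorm v.
Proof.
rewrite -ler_sqr ?nnegrE ?mulr_ge0 ?enorm_ge0// real_normK ?num_real//.
rewrite exprMn !enorm_sqr.
by have := psd_cauchy_schwarz u v (psd1 n); rewrite !qform_vdot !mul1mx.
Qed.

Lemma enormD n (u v : 'cV[R]_n) : enorm (u + v) <= enorm u + enorm v.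
Proof.
rewrite -ler_sqr ?nnegrE ?addr_ge0 ?enorm_ge0//.
rewrite sqrrD !enorm_sqr vdotDl !vdotDr (vdotC v u).
have := vdot_le u v; rewrite ler_norml => /andP[_]; lra.
Qed.

Lemma enorm_sum n (f : nat -> 'cV[R]_n) N :
  enorm (\sum_(0 <= i < N) f i) <= \sum_(0 <= i < N) enorm (f i).
Proof.
elim: N => [|N IHN]; first by rewrite !big_geq// enorm0.
by rewrite !big_nat_recr//=; apply: le_trans (enormD _ _) _; rewrite lerD2r.
Qed.

Lemma normr_coord_le_enorm n (v : 'cV[R]_n) i : `|v i 0| <= enorm v.
Proof.
rewrite -ler_sqr ?nnegrE ?enorm_ge0// real_normK ?num_real// enorm_sqr vdotE.
rewrite (bigD1 i)//= -expr2 lerDl; apply: sumr_ge0 => j _.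
by rewrite -expr2 sqr_ge0.
Qed.

Lemma enorm_le_sum_coord n (v : 'cV[R]_n) : enorm v <= \sum_i `|v i 0|.
Proof.
have s0 : 0 <= \sum_i `|v i 0| by apply: sumr_ge0.
rewrite -ler_sqr ?nnegrE ?enorm_ge0// enorm_sqr vdotE expr2 mulr_suml.
apply: ler_sum => i _; rewrite -[leLHS]ger0_norm -?expr2 ?sqr_ge0// normrX expr2.
by apply: ler_wpM2l => //; rewrite (bigD1 i)//= lerDl; apply: sumr_ge0.
Qed.

(** A crude entrywise bound, which makes the set in [spectral_norm] bounded, so that its [sup] is a
    genuine least upper bound. *)
Lemma enorm_mulmx_bounded m n (M : 'M[R]_(m, n)) :
  exists2 b, 0 <= b & forall v, enorm (M *m v) <= b * enorm v.
Proof.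
exists (\sum_i \sum_j `|M i j|).
  by apply: sumr_ge0 => i _; apply: sumr_ge0.
move=> v; apply: le_trans (enorm_le_sum_coord _) _.
rewrite mulr_suml; apply: ler_sum => i _; rewrite mxE mulr_suml.
apply: le_trans (ler_norm_sum _ _ _) _; apply: ler_sum => j _.
by rewrite normrM ler_wpM2l// normr_coord_le_enorm.
Qed.

Lemma has_sup_spectral_norm m n (M : 'M[R]_(m, n)) :
  has_sup [set enorm (M *m v) | v in [set v : 'cV[R]_n | enorm v <= 1]].
Proof.
split; first by exists (enorm (M *m 0)), 0; rewrite //= enorm0.
have [b b0 Mb] := enorm_mulmx_bounded M.
exists b => _ [v /= v1 <-]; apply: le_trans (Mb v) _.
by rewrite -[leRHS]mulr1 ler_wpM2l.
Qed.

Lemma spectral_norm_ge0 m n (M : 'M[R]_(m, n)) : 0 <= spectral_norm M.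
Proof.
have -> : 0 = enorm (M *m 0) by rewrite mulmx0 enorm0.
apply: ub_le_sup; first exact: (has_sup_spectral_norm M).2.
by exists 0; rewrite //= enorm0.
Qed.

Lemma enorm_mulmx_le m n (M : 'M[R]_(m, n)) v :
  enorm (M *m v) <= spectral_norm M * enorm v.
Proof.
have [->|v0] := eqVneq v 0; first by rewrite mulmx0 !enorm0 mulr0.
have ev0 : 0 < enorm v by rewrite lt_neqAle eq_sym enorm_eq0 v0 enorm_ge0.
rewrite -ler_pdivrMr//; apply: ub_le_sup.
  exact: (has_sup_spectral_norm M).2.
have ev1 : `|(enorm v)^-1| = (enorm v)^-1.
  by rewrite ger0_norm// invr_ge0 enorm_ge0.
exists ((enorm v)^-1 *: v) => /=.
  by rewrite enormZ ev1 mulVf ?gt_eqF.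
by rewrite -scalemxAr enormZ ev1 mulrC.
Qed.

(** By duality: the square of the left side is the pairing of [v] with [M *m (M^T *m v)], and one
    factor [enorm (M^T *m v)] cancels. *)
Lemma enorm_tr_mulmx_le m n (M : 'M[R]_(m, n)) v :
  enorm (M^T *m v) <= spectral_norm M * enorm v.
Proof.
have [->|v0] := eqVneq (M^T *m v) 0.
  by rewrite enorm0 mulr_ge0 ?spectral_norm_ge0 ?enorm_ge0.
have ev0 : 0 < enorm (M^T *m v) by rewrite lt_neqAle eq_sym enorm_eq0 v0 enorm_ge0.
rewrite -(ler_pM2r ev0) -expr2 enorm_sqr vdot_mulmx trmxK.
apply: le_trans (ler_norm _) _; apply: le_trans (vdot_le _ _) _.
by rewrite mulrAC mulrC ler_wpM2r ?enorm_ge0// enorm_mulmx_le.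
Qed.

Lemma qform_le n (M : 'M[R]_n) v : `|qform M v| <= spectral_norm M * enorm v ^+ 2.
Proof.
rewrite qform_vdot; apply: le_trans (vdot_le _ _) _.
by rewrite mulrC expr2 mulrA ler_wpM2r ?enorm_ge0// enorm_mulmx_le.
Qed.

(** Cauchy-Schwarz for the form [M] at the pair [M *m v], [v], whose pairing is the square of
    [enorm (M *m v)]; one such square cancels. *)
Lemma psd_enorm_mulmx_le n (M : 'M[R]_n) v : psd M ->
  enorm (M *m v) ^+ 2 <= spectral_norm M * qform M v.
Proof.
move=> M_psd; have [->|v0] := eqVneq (M *m v) 0.
  by rewrite enorm0 expr0n mulr_ge0 ?spectral_norm_ge0// (M_psd.2 v).
have ev0 : 0 < enorm (M *m v) ^+ 2.
  by rewrite exprn_even_gt0//= enorm_eq0.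
rewrite -(ler_pM2r ev0) -expr2 {1}enorm_sqr.
apply: le_trans (psd_cauchy_schwarz _ _ M_psd) _.
rewrite mulrAC ler_wpM2r ?(M_psd.2 v)//.
exact: le_trans (ler_norm _) (qform_le _ _).
Qed.

Lemma pd_psd k (M : 'M[R]_k) : pd M -> psd M.
Proof.
move=> [MT M0]; split=> // y; have [->|/M0/ltW//] := eqVneq y 0.
by rewrite /qform mulmx0 mxE.
Qed.

Lemma pd_unitmx n (M : 'M[R]_n) : pd M -> M \in unitmx.
Proof.
move=> [MT M0]; rewrite -row_free_unit; apply: inj_row_free => v vM0.
have [vT0|/M0] := eqVneq v^T 0; first by rewrite -[v]trmxK vT0 trmx0.
by rewrite /qform trmxK vM0 mul0mx mxE ltxx.
Qed.

End EuclideanSpace.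

(** * Stable linear recursions with vanishing forcing *)

Section StableRecursion.
Variable R : realType.

Lemma squeeze0 (u v : R ^nat) : (forall t, 0 <= u t) ->
  (forall t, u t <= v t) -> v t @[t --> \oo] --> 0 -> u t @[t --> \oo] --> 0.
Proof.
move=> u0 uv v0; apply: (@squeeze_cvgr _ _ _ _ (fun=> 0) v) => //.
  by near=> t; rewrite u0 uv.
exact: cvg_cst.
Unshelve. all: by end_near. Qed.

Lemma contraction_cvg0 (a : R) (y f : R ^nat) : 0 <= a < 1 ->
  (forall t, 0 <= y t) -> (forall t, y t.+1 <= a * y t + f t) ->
  f t @[t --> \oo] --> 0 -> y t @[t --> \oo] --> 0.
Proof.
move=> /andP[a0 a1] y0 yS f0; apply/cvgr0Pnorm_le => e e0.
(* With this bound on the forcing, [e / 2] is the fixed point of the affine majorant of the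
   recursion. *)
have e'0 : 0 < e * (1 - a) / 2 by rewrite divr_gt0// mulr_gt0// subr_gt0.
move/cvgr0Pnorm_le : f0 => /(_ _ e'0) [N _ fN].
have yN k : y (N + k)%N <= a ^+ k * y N + e / 2.
  elim: k => [|k IHk]; first by rewrite addn0 expr0 mul1r; lra.
  rewrite addnS; apply: le_trans (yS _) _.
  have := fN (N + k)%N (leq_addr _ _); rewrite /= => /(le_trans (ler_norm _)) fk.
  have := ler_wpM2l a0 IHk; rewrite exprS; lra.
have ak0 : (a ^+ k * y N) @[k --> \oo] --> 0.
  rewrite -[0](mul0r (y N)); apply: cvgMl; apply: cvg_expr.
  by rewrite ger0_norm.
move/cvgr0Pnorm_le : ak0 => /(_ (e / 2)) []; first by rewrite divr_gt0.
move=> K _ aK; exists (N + K)%N => //= t /= NKt.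
have Nt : (N <= t)%N by apply: leq_trans NKt; rewrite leq_addr.
rewrite ger0_norm// -(subnKC Nt); apply: le_trans (yN _) _.
have := aK (t - N)%N; rewrite /= leq_subRL// => /(_ NKt).
move=> /(le_trans (ler_norm _)); lra.
Qed.

Local Notation C := R[i].
Local Notation normc := (@ComplexField.Normc.normc R).

(** The eigenvalues are complex, so the recursion is studied over [C], in the l1 norm. *)
Let cnorm n (v : 'cV[C]_n) : R := \sum_i normc (v i 0).

Let normc_ge0 z : 0 <= normc z.
Proof. by case: z => a b; exact: sqrtr_ge0. Qed.

Let cnorm_ge0 n (v : 'cV[C]_n) : 0 <= cnorm v.
Proof. by apply: sumr_ge0. Qed.

Let cnormD n (u v : 'cV[C]_n) : cnorm (u + v) <= cnorm u + cnorm v.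
Proof.
rewrite /cnorm -big_split/=; apply: ler_sum => i _; rewrite mxE.
exact: le_normcD.
Qed.

Let cnormZ n z (v : 'cV[C]_n) : cnorm (z *: v) = normc z * cnorm v.
Proof.
rewrite /cnorm mulr_sumr; apply: eq_bigr => i _.
by rewrite mxE ComplexField.Normc.normcM.
Qed.

Let cnorm_mulmx n (M : 'M[C]_n) :
  exists2 b, 0 <= b & forall v : 'cV[C]_n, cnorm (M *m v) <= b * cnorm v.
Proof.
exists (\sum_i \sum_j normc (M i j)).
  by apply: sumr_ge0 => i _; apply: sumr_ge0.
move=> v; rewrite mulr_suml; apply: ler_sum => i _; rewrite mxE mulr_suml.
apply: (@le_trans _ _ (\sum_j normc (M i j * v j 0))).
  elim/big_ind2 : _ => [|x1 x2 y1 y2 h1 h2|//].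
    by rewrite ComplexField.Normc.normc0.
  by apply: le_trans (le_normcD _ _) _; exact: lerD.
apply: ler_sum => j _; rewrite ComplexField.Normc.normcM ler_wpM2l//.
by rewrite /cnorm (bigD1 j)//= lerDl; apply: sumr_ge0.
Qed.

(* Peeling off one factor [M - z] at a time reduces the claim to scalar
   contractions by the moduli of the roots. *)
Let annihilated_recursion_cvg0 n (M : 'M[C]_n.+1) (rs : seq C)
    (x f : nat -> 'cV[C]_n.+1) :
  (forall z, z \in rs -> normc z < 1) ->
  (forall t, x t.+1 = M *m x t + f t) ->
  (forall t, horner_mx M (\prod_(z <- rs) ('X - z%:P)) *m x t = 0) ->
  cnorm (f t) @[t --> \oo] --> 0 -> cnorm (x t) @[t --> \oo] --> 0.
Proof.
elim: rs x f => [|z rs IHrs] x f rs1 xS x0 f0.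
  have -> : (fun t => cnorm (x t)) = fun=> 0.
    apply/funext => t; have := x0 t; rewrite big_nil rmorph1 mul1mx => ->.
    by rewrite /cnorm big1// => i _; rewrite mxE ComplexField.Normc.normc0.
  exact: cvg_cst.
have Mz : horner_mx M ('X - z%:P) = M - z%:M.
  by rewrite rmorphB/= horner_mx_X horner_mx_C.
(* [M - z] commutes with [M], so this sequence obeys the same recursion with forcing [(M - z) f] and
   is annihilated by the remaining factors. *)
have y0 : cnorm ((M - z%:M) *m x t) @[t --> \oo] --> 0.
  apply: (IHrs _ (fun t => (M - z%:M) *m f t)) => [z' z'rs|t|t|].
  - by apply: rs1; rewrite inE z'rs orbT.
  - rewrite xS mulmxDr !mulmxA; congr (_ *m _ + _).
    by rewrite mulmxBl mulmxBr scalar_mxC.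
  - by have := x0 t; rewrite big_cons mulrC rmorphM/= Mz mulmxA.
  - have [b b0 Mb] := cnorm_mulmx (M - z%:M).
    apply: squeeze0 (fun t => Mb (f t)) _ => //.
    by rewrite -[0](mulr0 b); exact: cvgMr.
apply: (@contraction_cvg0 (normc z) _
  (fun t => cnorm ((M - z%:M) *m x t) + cnorm (f t))) => //.
- by rewrite normc_ge0 rs1// inE eqxx.
- move=> t; rewrite xS -cnormZ.
  have -> : M *m x t + f t = z *: x t + ((M - z%:M) *m x t + f t).
    by rewrite mulmxBl mul_scalar_mx addrA addrCA subrr addr0.
  by apply: le_trans (cnormD _ _) _; rewrite lerD2l.
- by rewrite -[0](addr0 0); exact: cvgD.
Qed.

(** The eigenvalues are the finitely many roots of the characteristic polynomial; the sum of their
    moduli bounds the set under [sup]. *)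
Lemma spectral_radius_lt1_eigenvalue n (M : 'M[R]_n) z :
  spectral_radius M < 1 -> eigenvalue (map_mx (real_complex R) M) z ->
  normc z < 1.
Proof.
move=> M1 Mz; apply: le_lt_trans M1; apply: ub_le_sup; last by exists z.
have [rs char_rs] := closed_field_poly_normal
  (char_poly (map_mx (real_complex R) M)).
exists (\sum_(y <- rs) normc y) => _ [y /= + <-].
rewrite eigenvalue_root_char char_rs (monicP (char_poly_monic _)) scale1r.
rewrite root_prod_XsubC => y_rs.
by rewrite (big_rem y)//= lerDl; apply: sumr_ge0.
Qed.

(** The characteristic polynomial splits over [C] with all roots inside the unit disc, and by
    Cayley-Hamilton it annihilates the complexified matrix. *)
Lemma stable_recursion_cvg0 n (M : 'M[R]_n) (x f : nat -> 'cV[R]_n) :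
  spectral_radius M < 1 -> (forall t, x t.+1 = M *m x t + f t) ->
  enorm (f t) @[t --> \oo] --> 0 -> enorm (x t) @[t --> \oo] --> 0.
Proof.
case: n M x f => [|n] M x f M1 xS f0.
  have -> : (fun t => enorm (x t)) = fun=> 0.
    by apply/funext => t; rewrite [x t]flatmx0 enorm0.
  exact: cvg_cst.
pose rc n := map_mx (real_complex R) : 'cV[R]_n -> 'cV[C]_n.
have cnorm_rc (v : 'cV[R]_n.+1) : cnorm (rc _ v) = \sum_i `|v i 0|.
  apply: eq_bigr => i _.
  by rewrite mxE /= expr0n/= addr0 sqrtr_sqr.
have [rs char_rs] := closed_field_poly_normal
  (char_poly (map_mx (real_complex R) M)).
rewrite (monicP (char_poly_monic _)) scale1r in char_rs.
apply: (@squeeze0 _ (fun t => cnorm (rc _ (x t)))) => [t|t|].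
- exact: enorm_ge0.
- by rewrite cnorm_rc enorm_le_sum_coord.
apply: (@annihilated_recursion_cvg0 n (map_mx (real_complex R) M) rs _
  (fun t => rc _ (f t))) => [z z_rs|t|t|].
- apply: spectral_radius_lt1_eigenvalue M1 _.
  by rewrite eigenvalue_root_char char_rs root_prod_XsubC.
- by rewrite /rc xS map_mxD map_mxM.
- by rewrite -char_rs Cayley_Hamilton mul0mx.
- apply: (@squeeze0 _ (fun t => n.+1%:R * enorm (f t))) => // [t|].
    rewrite cnorm_rc; apply: le_trans (ler_sum _ (fun i _ =>
      normr_coord_le_enorm (f t) i)) _.
    by rewrite sumr_const card_ord mulr_natl.
  by rewrite -[0](mulr0 n.+1%:R); exact: cvgMr.
Qed.

Lemma spectral_radius_ge0 n (M : 'M[R]_n) : 0 <= spectral_radius M.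
Proof.
rewrite /spectral_radius; set E := (X in sup X).
(* A set without supremum has [sup] equal to 0; in dimension 0 the spectrum is empty and this case
   occurs. *)
have [[[e Ee] ubE]|/sup_out ->//] := pselect (has_sup E).
apply: le_trans (ub_le_sup ubE Ee).
by case: Ee => -[a b] _ <-; exact: sqrtr_ge0.
Qed.

End StableRecursion.

(** * Energy bound for geometrically weighted filters *)

Section GeometricFilter.
Variable R : realType.

Lemma geometric_sum_le (l : R) N : 0 <= l < 1 ->
  \sum_(0 <= i < N) l ^+ i <= (1 - l)^-1.
Proof.
move=> /andP[l0 l1]; have l1' : 0 < 1 - l by rewrite subr_gt0.
rewrite -[leRHS]mul1r ler_pdivlMr//.
have -> : (\sum_(0 <= i < N) l ^+ i) * (1 - l) = 1 - l ^+ N.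
  elim: N => [|N IHN]; first by rewrite big_geq// mul0r expr0 subrr.
  by rewrite big_nat_recr//= mulrDl IHN exprSr; ring.
by rewrite lerBlDr lerDl exprn_ge0.
Qed.

Lemma weighted_cauchy_schwarz (p a : R ^nat) N : (forall i, 0 <= p i) ->
  (\sum_(0 <= i < N) p i * a i) ^+ 2 <=
  (\sum_(0 <= i < N) p i) * \sum_(0 <= i < N) p i * a i ^+ 2.
Proof.
move=> p0; elim: N => [|N IHN]; first by rewrite !big_geq// expr0n mul0r.
rewrite !big_nat_recr//=.
set S := \sum_(0 <= i < N) p i * a i in IHN *.
set P := \sum_(0 <= i < N) p i in IHN *.
set Q := \sum_(0 <= i < N) p i * a i ^+ 2 in IHN *.
have P0 : 0 <= P by apply: sumr_ge0.
have Q0 : 0 <= Q by apply: sumr_ge0 => i _; rewrite mulr_ge0 ?sqr_ge0.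
(* This is what the new term adds, divided by [p N]. After multiplication by [P] it follows from
   [S ^+ 2 <= P * Q] and the square of [P * a N - S]. *)
suff SPQ : 2 * S * a N <= P * a N ^+ 2 + Q.
  have := ler_wpM2l (p0 N) SPQ; lra.
have [P_eq0|P_neq0] := eqVneq P 0.
  have S0 : S = 0.
    by apply/eqP; rewrite -sqrf_eq0 eq_le sqr_ge0 andbT -(mul0r Q) -P_eq0.
  by rewrite S0 P_eq0 mulr0 !mul0r add0r.
have P_gt0 : 0 < P by rewrite lt_neqAle eq_sym P_neq0.
rewrite -(ler_pM2l P_gt0); have := sqr_ge0 (P * a N - S); lra.
Qed.

(** Young's inequality for a geometric kernel: Cauchy-Schwarz with weights [l ^+ i] costs one factor
    [1 / (1 - l)], and exchanging the two sums costs the other. The bound is uniform in [T] and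
    [N]. *)
Lemma geometric_filter_energy_le (l W : R) (a : R ^nat) T N : 0 <= l < 1 ->
  (forall T, \sum_(0 <= t < T) a t ^+ 2 <= W) ->
  \sum_(0 <= t < T) (\sum_(0 <= i < N) l ^+ i * a (t + i)%N) ^+ 2 <=
  W / (1 - l) ^+ 2.
Proof.
move=> l01 aW; have /andP[l0 l1] := l01.
have li i : 0 <= l ^+ i by exact: exprn_ge0.
have l1' : 0 < 1 - l by rewrite subr_gt0.
have W0 : 0 <= W by have := aW 0; rewrite big_geq.
have shift i : \sum_(0 <= t < T) a (t + i)%N ^+ 2 <= W.
  apply: le_trans (aW (i + T)%N); rewrite [leRHS](@big_cat_nat _ _ _ i)//= ?leq_addr//.
  have -> : \sum_(i <= t < i + T) a t ^+ 2 = \sum_(0 <= t < T) a (t + i)%N ^+ 2.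
    by have := big_addn 0 (i + T) i xpredT (fun t => a t ^+ 2); rewrite add0n addKn.
  by rewrite lerDr; apply: sumr_ge0 => t _; rewrite sqr_ge0.
apply: (@le_trans _ _ (\sum_(0 <= t < T) (1 - l)^-1 *
    \sum_(0 <= i < N) l ^+ i * a (t + i)%N ^+ 2)).
  apply: ler_sum => t _.
  apply: le_trans (weighted_cauchy_schwarz (fun i => a (t + i)%N) N li) _.
  apply: ler_wpM2r (geometric_sum_le N l01).
  by apply: sumr_ge0 => i _; rewrite mulr_ge0 ?sqr_ge0.
rewrite -mulr_sumr exchange_big/=.
apply: (@le_trans _ _ ((1 - l)^-1 * \sum_(0 <= i < N) l ^+ i * W)).
  rewrite ler_wpM2l ?invr_ge0 ?(ltW l1')//; apply: ler_sum => i _.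
  by rewrite -mulr_sumr ler_wpM2l.
rewrite -mulr_suml mulrA mulrC ler_wpM2l// expr2 invfM.
by rewrite ler_wpM2l ?invr_ge0 ?(ltW l1')// geometric_sum_le.
Qed.

End GeometricFilter.

(** * Limits of matrices, entry by entry *)

Section MatrixLimits.
Variable R : realType.

Lemma cvg_mx m n (f : nat -> 'M[R]_(m, n)) (l : 'M[R]_(m, n)) :
  (forall i j, f k i j @[k --> \oo] --> l i j) -> f k @[k --> \oo] --> l.
Proof.
move=> fl A [P lP PA].
have : \forall k \near \oo, forall i j, P i j (f k i j).
  apply: filter_forall => i; apply: filter_forall => j.
  exact: (fl i j _ (lP i j)).
by apply: filterS => k; exact: PA.
Qed.

Lemma cvg_mx_coord m n (f : nat -> 'M[R]_(m, n)) (l : 'M[R]_(m, n)) i j :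
  f k @[k --> \oo] --> l -> f k i j @[k --> \oo] --> l i j.
Proof.
move=> fl; apply: (cvg_comp f (fun M : 'M[R]_(m, n) => M i j) fl).
exact: coord_continuous.
Qed.

Lemma cvg_mulmx m n p (M : 'M[R]_(m, n)) (f : nat -> 'M[R]_(n, p)) l :
  f k @[k --> \oo] --> l -> (M *m f k) @[k --> \oo] --> M *m l.
Proof.
move=> fl; apply: cvg_mx => i j; rewrite mxE.
under eq_fun do rewrite mxE.
apply: cvg_big => [|k _]; first exact: add_continuous.
by apply: cvgMr; exact: cvg_mx_coord.
Qed.

Lemma cvg_enorm_sqr n (f : nat -> 'cV[R]_n) l :
  f k @[k --> \oo] --> l -> enorm (f k) ^+ 2 @[k --> \oo] --> enorm l ^+ 2.
Proof.
move=> fl; rewrite enorm_sqr vdotE; under eq_fun do rewrite enorm_sqr vdotE.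
by apply: cvg_big => [|i _]; [exact: add_continuous | apply: cvgM]; exact: cvg_mx_coord.
Qed.

(** The candidate limit is read off entrywise; each scalar series converges absolutely, being
    dominated by the Euclidean norms. *)
Lemma is_cvg_series_enorm n (f : nat -> 'cV[R]_n) :
  cvgn (series (fun i => enorm (f i))) -> cvgn (fun N => \sum_(0 <= i < N) f i).
Proof.
move=> cf; pose l : 'cV[R]_n := \col_i limn (series (fun k => f k i 0)).
apply/cvg_ex; exists l; apply: cvg_mx => i j; rewrite ord1 mxE.
under eq_fun do rewrite summxE.
apply: (@normed_cvg _ R^o); apply: series_le_cvg cf => k /=.
- exact: normr_ge0.
- exact: enorm_ge0.
- exact: normr_coord_le_enorm.
Qed.

End MatrixLimits.

Lemma bounded_series_cvg (R : realType) (u : R ^nat) W : (forall t, 0 <= u t) ->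
  (forall T, \sum_(0 <= t < T) u t <= W) -> cvgn (series u).
Proof.
move=> u0 uW; apply: nondecreasing_is_cvgn.
  by apply: nondecreasing_series => t _ _.
by exists W => _ /= [T _ <-]; exact: uW.
Qed.

Lemma cvg0_sqr (R : realType) (y : R ^nat) : (forall t, 0 <= y t) ->
  y t ^+ 2 @[t --> \oo] --> 0 -> y t @[t --> \oo] --> 0.
Proof.
move=> y0 yy0; have -> : y = (fun t => Num.sqrt (y t ^+ 2)).
  by apply/funext => t; rewrite sqrtr_sqr ger0_norm.
rewrite -[0]sqrtr0; exact: (cvg_comp _ _ yy0 (@sqrt_continuous R 0)).
Qed.

(** * Sequences of vectors tending to zero *)

Section VanishingVectors.
Variable R : realType.

(** A semidefinite weight controls [M *m y t] but not [y t] itself; for the state, detectability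
    closes this gap later. *)
Lemma psd_mulmx_cvg0 k (M : 'M[R]_k) (y : nat -> 'cV[R]_k) : psd M ->
  qform M (y t) @[t --> \oo] --> 0 -> enorm (M *m y t) @[t --> \oo] --> 0.
Proof.
move=> M_psd qy0.
apply: cvg0_sqr => [t|]; first exact: enorm_ge0.
apply: (squeeze0 _ (fun t => psd_enorm_mulmx_le (y t) M_psd)) => [t|].
  exact: sqr_ge0.
by rewrite -[0](mulr0 (spectral_norm M)); exact: cvgMr.
Qed.

Lemma enorm_mulmx_cvg0 k l (M : 'M[R]_(k, l)) (y : nat -> 'cV[R]_l) :
  enorm (y t) @[t --> \oo] --> 0 -> enorm (M *m y t) @[t --> \oo] --> 0.
Proof.
move=> y0; apply: (squeeze0 _ (fun t => enorm_mulmx_le M (y t))) => [t|].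
  exact: enorm_ge0.
by rewrite -[0](mulr0 (spectral_norm M)); exact: cvgMr.
Qed.

Lemma enormD_cvg0 k (y z : nat -> 'cV[R]_k) :
  enorm (y t) @[t --> \oo] --> 0 -> enorm (z t) @[t --> \oo] --> 0 ->
  enorm (y t + z t) @[t --> \oo] --> 0.
Proof.
move=> y0 z0; apply: (squeeze0 _ (fun t => enormD (y t) (z t))) => [t|].
  exact: enorm_ge0.
by rewrite -[0](addr0 0); exact: cvgD.
Qed.

Lemma qform_cvg0 k (M : 'M[R]_k) (y : nat -> 'cV[R]_k) :
  enorm (y t) @[t --> \oo] --> 0 -> qform M (y t) @[t --> \oo] --> 0.
Proof.
move=> y0; apply/norm_cvg0P.
apply: (squeeze0 _ (fun t => qform_le M (y t))) => //.
rewrite -[0](mulr0 (spectral_norm M)); apply: cvgMr.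
by rewrite -[0](mulr0 0); under eq_fun do rewrite expr2; exact: cvgM.
Qed.

End VanishingVectors.

(** * Square-summable sequences and their energies *)

Section SquareSummable.
Variables (R : realType) (n : nat).
Implicit Types w : nat -> 'cV[R]_n.

Lemma l2norm_sqr w :
  (l2norm w ^+ 2 = \sum_(0 <= t <oo) (enorm (w t) ^+ 2)%:E)%E.
Proof.
by apply/sqr_sqrte/nneseries_ge0 => t _ _; rewrite lee_fin sqr_ge0.
Qed.

(** Passes from the extended-real norm to a real number bounding all partial energies; the equality
    keeps the final bound sharp. *)
Lemma L2_energy w : L2 w -> exists2 W, (l2norm w ^+ 2 = W%:E)%E &
  forall T, \sum_(0 <= t < T) enorm (w t) ^+ 2 <= W.
Proof.
move=> w2; have w0 : (0 <= l2norm w)%E by exact: sqrte_ge0.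
have fw : l2norm w \is a fin_num by rewrite ge0_fin_numE.
exists (fine (l2norm w) ^+ 2); first by rewrite EFin_expe fineK.
move=> T; rewrite -lee_fin EFin_expe fineK// l2norm_sqr -sumEFin.
by apply: nneseries_lim_ge => t _ _; rewrite lee_fin sqr_ge0.
Qed.

Lemma L2_unit_ball_L2 w : L2_unit_ball w -> L2 w.
Proof. by move=> w1; apply: le_lt_trans w1 _; rewrite ltry. Qed.

Lemma energy_L2 w W :
  (forall T, \sum_(0 <= t < T) enorm (w t) ^+ 2 <= W) -> L2 w.
Proof.
move=> wW; have e0 t : (0 <= (enorm (w t) ^+ 2)%:E)%E by rewrite lee_fin sqr_ge0.
have s0 : (0 <= \sum_(0 <= t <oo) (enorm (w t) ^+ 2)%:E)%E.
  exact: nneseries_ge0.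
rewrite /L2/= -ge0_fin_numE ?sqrte_ge0// sqrte_fin_num// ge0_fin_numE//.
apply: (@le_lt_trans _ _ W%:E); last exact: ltry.
apply: lime_le; first exact: is_cvg_nneseries.
near=> T; rewrite sumEFin lee_fin; exact: wW.
Unshelve. all: by end_near. Qed.

Lemma energy_cvg0 w W :
  (forall T, \sum_(0 <= t < T) enorm (w t) ^+ 2 <= W) ->
  enorm (w t) @[t --> \oo] --> 0.
Proof.
move=> wW; apply: cvg0_sqr => [t|]; first exact: enorm_ge0.
apply: cvg_series_cvg_0; apply: bounded_series_cvg wW => t.
exact: sqr_ge0.
Qed.

Lemma energyB w1 w2 W1 W2 :
  (forall T, \sum_(0 <= t < T) enorm (w1 t) ^+ 2 <= W1) ->
  (forall T, \sum_(0 <= t < T) enorm (w2 t) ^+ 2 <= W2) ->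
  forall T, \sum_(0 <= t < T) enorm (w1 t - w2 t) ^+ 2 <= 2 * W1 + 2 * W2.
Proof.
move=> w1W w2W T; apply: (@le_trans _ _ (\sum_(0 <= t < T)
    (2 * enorm (w1 t) ^+ 2 + 2 * enorm (w2 t) ^+ 2))); last first.
  by rewrite big_split/= -!mulr_sumr lerD// ler_wpM2l.
apply: ler_sum => t _.
have := enormD (w1 t) (- w2 t); rewrite enormN => tri.
have := lerXn2r 2 (enorm_ge0 _) (addr_ge0 (enorm_ge0 _) (enorm_ge0 _)) tri.
have := sqr_ge0 (enorm (w1 t) - enorm (w2 t)).
by rewrite sqrrB sqrrD; lra.
Qed.

End SquareSummable.

(** * The costate generated by a disturbance *)

Section Costate.
Variables (R : realType) (n : nat) (F P : 'M[R]_n) (c lambda : R).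
Hypothesis c1 : 1 < c.
Hypothesis lambda01 : 0 <= lambda < 1.
Hypothesis F_decay :
  forall i, (1 <= i)%N -> spectral_norm (F ^+ i) <= c * lambda ^+ i.
Let c0 : 0 <= c.
Proof. exact: ltW (lt_trans ltr01 c1). Qed.

Implicit Types w : nat -> 'cV[R]_n.

(** The anticipative term of the offline law, written as the very limit that occurs in
    [ce_policy]. *)
Definition costate w t : 'cV[R]_n :=
  limn (fun N => \sum_(0 <= i < N) (F^T ^+ i *m P *m w (t + i)%N)).

Lemma trmx_exp i : F^T ^+ i = (F ^+ i)^T.
Proof.
elim: i => [|i IHi]; first by rewrite !expr0 trmx1.
by rewrite exprS exprSr IHi -!mulmxE trmx_mul.
Qed.

Lemma enorm_costate_term i v :
  enorm (F^T ^+ i *m P *m v) <= c * spectral_norm P * (lambda ^+ i * enorm v).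
Proof.
have Pv := enorm_mulmx_le P v.
have Pv0 : 0 <= spectral_norm P * enorm v.
  by rewrite mulr_ge0 ?spectral_norm_ge0 ?enorm_ge0.
have -> : c * spectral_norm P * (lambda ^+ i * enorm v) =
    (c * lambda ^+ i) * (spectral_norm P * enorm v) by ring.
(* [F_decay] starts at exponent 1; at exponent 0 the power is the identity and [1 < c] suffices. *)
case: i => [|i].
  rewrite expr0 mul1mx mulr1; apply: le_trans Pv _.
  by rewrite ler_peMl// ltW.
rewrite trmx_exp -mulmxA; apply: le_trans (enorm_tr_mulmx_le _ _) _.
by rewrite ler_pM ?spectral_norm_ge0 ?enorm_ge0// F_decay.
Qed.

Variables (w : nat -> 'cV[R]_n) (W : R).
Hypothesis w_energy : forall T, \sum_(0 <= t < T) enorm (w t) ^+ 2 <= W.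

Lemma cvg_costate t :
  \sum_(0 <= i < N) (F^T ^+ i *m P *m w (t + i)%N) @[N --> \oo] --> costate w t.
Proof.
have /andP[l0 l1] := lambda01.
(* Finite energy bounds the sequence uniformly, so a geometric series dominates the terms. *)
have w_le s : enorm (w s) <= 1 + W.
  have ws : enorm (w s) ^+ 2 <= W.
    apply: le_trans (w_energy s.+1); rewrite big_nat_recr//= lerDr.
    by apply: sumr_ge0 => i _; rewrite sqr_ge0.
  move: (sqr_ge0 (enorm (w s) - 1)) (sqr_ge0 (enorm (w s))); rewrite sqrrB1; lra.
have W0 : 0 <= 1 + W by apply: le_trans (w_le 0); exact: enorm_ge0.
have cP0 : 0 <= c * spectral_norm P.
  by rewrite mulr_ge0 ?spectral_norm_ge0.
apply: is_cvg_series_enorm.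
apply: (@series_le_cvg _ _
  (geometric (c * spectral_norm P * (1 + W)) lambda)) => [i|i|i|].
- exact: enorm_ge0.
- by rewrite /= mulr_ge0 ?exprn_ge0// mulr_ge0.
- apply: le_trans (enorm_costate_term _ _) _; rewrite /= -[leRHS]mulrA.
  by rewrite ler_wpM2l// mulrC ler_wpM2r ?exprn_ge0.
- by apply: is_cvg_geometric_series; rewrite ger0_norm.
Qed.

(** Split off the term [i = 0] of the partial sums, factor [F^T] out of the rest, and pass to the
    limit on both sides. *)
Lemma costate_rec t : costate w t = P *m w t + F^T *m costate w t.+1.
Proof.
have sumS N : \sum_(0 <= i < N.+1) (F^T ^+ i *m P *m w (t + i)%N) =
    P *m w t + F^T *m \sum_(0 <= i < N) (F^T ^+ i *m P *m w (t.+1 + i)%N).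
  rewrite big_nat_recl//= addn0 expr0 mul1mx mulmx_sumr; congr (_ + _).
  by apply: eq_bigr => i _; rewrite exprS -!mulmxE !mulmxA addSnnS.
have := @cvg_costate t; rewrite -cvg_shiftS.
under eq_fun => N do rewrite sumS.
move=> /cvg_lim <-//; apply/cvg_lim => //.
by apply: cvgD; [exact: cvg_cst | apply: cvg_mulmx; exact: cvg_costate].
Qed.

(** The filter bound holds for every truncation [N]; with [T] fixed, it survives the limit in
    [N]. *)
Lemma costate_energy T :
  \sum_(0 <= t < T) enorm (costate w t) ^+ 2 <=
  W * (spectral_norm P ^+ 2 * (c ^+ 2 / (1 - lambda) ^+ 2)).
Proof.
have cP0 : 0 <= c * spectral_norm P.
  by rewrite mulr_ge0 ?spectral_norm_ge0.
have partial_sums_cvg : (\sum_(0 <= t < T) enorm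
    (\sum_(0 <= i < N) (F^T ^+ i *m P *m w (t + i)%N)) ^+ 2) @[N --> \oo] -->
    \sum_(0 <= t < T) enorm (costate w t) ^+ 2.
  apply: cvg_big => [|t _]; first exact: add_continuous.
  by apply: cvg_enorm_sqr; exact: cvg_costate.
apply: (cvgr_to_le partial_sums_cvg); near=> N.
have -> : W * (spectral_norm P ^+ 2 * (c ^+ 2 / (1 - lambda) ^+ 2)) =
  (c * spectral_norm P) ^+ 2 * (W / (1 - lambda) ^+ 2) by ring.
apply: le_trans (ler_wpM2l (sqr_ge0 _)
  (geometric_filter_energy_le T N lambda01 w_energy)).
rewrite mulr_sumr; apply: ler_sum => t _; rewrite -exprMn ler_sqr ?nnegrE.
- apply: le_trans (enorm_sum _ _) _; rewrite mulr_sumr; apply: ler_sum => i _.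
  exact: enorm_costate_term.
- exact: enorm_ge0.
- rewrite mulr_ge0//; apply: sumr_ge0 => i _.
  by rewrite mulr_ge0 ?exprn_ge0 ?enorm_ge0//; case/andP: lambda01.
Unshelve. all: by end_near. Qed.

End Costate.

Lemma costateB (R : realType) n (F P : 'M[R]_n) c lambda w1 w2 W1 W2 t :
  1 < c -> 0 <= lambda < 1 ->
  (forall i, (1 <= i)%N -> spectral_norm (F ^+ i) <= c * lambda ^+ i) ->
  (forall T, \sum_(0 <= t < T) enorm (w1 t) ^+ 2 <= W1) ->
  (forall T, \sum_(0 <= t < T) enorm (w2 t) ^+ 2 <= W2) ->
  costate F P (fun t => w1 t - w2 t) t = costate F P w1 t - costate F P w2 t.
Proof.
move=> c1 l01 Fd w1W w2W; apply: cvg_lim => //.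
under eq_fun => N.
  under eq_bigr do rewrite mulmxBr.
  rewrite sumrB.
  over.
by apply: cvgB; apply: cvg_costate => //; eassumption.
Qed.

(** * Completion of squares along the Riccati equation *)

Section CompletionOfSquares.
Variables (R : realType) (n m : nat) (A : 'M[R]_n) (B : 'M[R]_(n, m)).
Variables (Q QT : 'M[R]_n) (Rc : 'M[R]_m) (P : 'M[R]_n).
Hypotheses (hRc : pd Rc) (hP : psd P).

Let S := input_hessian B Rc P.
Let K := lqr_gain A B Rc P.
Let F := lqr_closed_loop A B Rc P.
Let H := lqr_H B Rc P.

Hypothesis dare : P = Q + A^T *m P *m A
  - A^T *m P *m B *m invmx S *m B^T *m P *m A.

Lemma qformD k (M N : 'M[R]_k) v : qform (M + N) v = qform M v + qform N v.
Proof. by rewrite !qform_vdot mulmxDl vdotDr. Qed.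

Lemma qformN k (M : 'M[R]_k) v : qform (- M) v = - qform M v.
Proof. by rewrite !qform_vdot mulNmx vdotNr. Qed.

Lemma qform_conj k l (M : 'M[R]_k) (N : 'M[R]_(k, l)) v :
  qform (N^T *m M *m N) v = qform M (N *m v).
Proof. by rewrite !qform_vdot -!mulmxA vdot_mulmx. Qed.

Lemma vdot_sym k (M : 'M[R]_k) u v :
  M^T = M -> vdot u (M *m v) = vdot v (M *m u).
Proof. by move=> MT; rewrite vdotC vdot_mulmx MT. Qed.

Lemma pd_input_hessian : pd S.
Proof.
split.
  by rewrite /S /input_hessian linearD/= !trmx_mul trmxK hRc.1 hP.1 mulmxA.
move=> v v0; rewrite qformD qform_conj ltr_wpDr ?hRc.2//.
exact: hP.2.
Qed.

Lemma mul_input_hessianV k (N : 'M[R]_(m, k)) : S *m (invmx S *m N) = N.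
Proof. by rewrite mulmxA mulmxV ?mul1mx// pd_unitmx//; exact: pd_input_hessian. Qed.

(** A costate error [v] shifts the input by [S^-1 B^T v]; [H] measures the [S]-energy of that
    shift. *)
Lemma qform_lqr_H v :
  qform H v = qform S (invmx S *m B^T *m v).
Proof.
rewrite !qform_vdot -[in RHS]mulmxA mul_input_hessianV /H /lqr_H.
by rewrite -!mulmxA [RHS]vdotC !vdot_mulmx trmxK.
Qed.

(** One step of dynamic programming: [y] is the next state and [g] stands for [F^T v_(t+1)]. The
    Riccati equation matches the terms quadratic in [x], and [v = P w + g] the cross terms. *)
Lemma complete_square x u w g v : v = P *m w + g ->
  let y := A *m x + B *m u + w in
  qform Q x + qform Rc u + (qform P y + 2 * vdot y g) =
  qform P x + 2 * vdot x (F^T *m v)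
  + qform S (u + K *m x + invmx S *m B^T *m v)
  + (qform P w + 2 * vdot w g - qform H v).
Proof.
move=> v_def y; rewrite qform_lqr_H.
set k := K *m x; set s := invmx S *m B^T *m v.
set a := A *m x; set b := B *m u.
have ST := pd_input_hessian.1; have PT := hP.1.
(* This and [Ss] clear the inverse of [S]; what remains is linear arithmetic in the pairings of [a],
   [b], [k], [s], [u], [w], [g]. *)
have Sk : S *m k = B^T *m (P *m a).
  by rewrite /k /a /K /lqr_gain -!mulmxA mul_input_hessianV.
have Ss : S *m s = B^T *m v by rewrite /s -mulmxA mul_input_hessianV.
have hQ : qform Q x = qform P x - qform P a + qform S k.
  rewrite [in qform P x]dare qformD qformD qformN qform_conj -/a.
  suff -> : qform (A^T *m P *m B *m invmx S *m B^T *m P *m A) x = qform S k.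
    by ring.
  rewrite !qform_vdot Sk /k /K /lqr_gain -!mulmxA -/a.
  rewrite [RHS]vdotC !vdot_mulmx !trmxK PT -/a.
  by rewrite -vdot_mulmx.
have hR : qform Rc u = qform S u - qform P b.
  by rewrite qformD qform_conj -/b; ring.
have hF : vdot x (F^T *m v) = vdot a (P *m w) + vdot a g - vdot k (S *m s).
  rewrite -vdot_mulmx /F /lqr_closed_loop mulmxBl vdotDl vdotNl -/a.
  by rewrite -vdotDr -v_def Ss -vdot_mulmx /k mulmxA.
have hbk : vdot b (P *m a) = vdot u (S *m k) by rewrite Sk vdot_mulmx.
have hbs : vdot b (P *m w) + vdot b g = vdot u (S *m s).
  by rewrite Ss -vdotDr -v_def vdot_mulmx.
rewrite hQ hR hF !qform_vdot /y -/a -/b !mulmxDr !vdotDl !vdotDr.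
rewrite (vdot_sym a b PT) (vdot_sym w a PT) (vdot_sym w b PT).
rewrite (vdot_sym s u ST) (vdot_sym s k ST) (vdot_sym k u ST).
rewrite hbk; move: hbs; lra.
Qed.

Variables (w v : nat -> 'cV[R]_n) (x0 : 'cV[R]_n).
Hypothesis v_rec : forall t, v t = P *m w t + F^T *m v t.+1.

(* Equal to the optimal cost-to-go from [x] at time [t] up to a constant
   independent of [x], whose decrements are [lq_drift]. *)
Definition lq_value t x := qform P x + 2 * vdot x (F^T *m v t).

(** Squared distance, in the weight [S], from [u t] to the offline law [- K x - S^-1 B^T v] at the
    state that [u] itself has reached. *)
Definition lq_excess (u : nat -> 'cV[R]_m) t : R :=
  qform S (u t + K *m state A B u w x0 t + invmx S *m B^T *m v t).

Definition lq_drift t : R :=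
  qform P (w t) + 2 * vdot (w t) (F^T *m v t.+1) - qform H (v t).

(** [complete_square] telescopes in [lq_value]; the input enters only through the terminal value and
    the excess. *)
Lemma running_costE u T :
  \sum_(0 <= t < T) (qform Q (state A B u w x0 t) + qform Rc (u t)) =
  lq_value 0 x0 - lq_value T (state A B u w x0 T) +
  \sum_(0 <= t < T) lq_excess u t + \sum_(0 <= t < T) lq_drift t.
Proof.
elim: T => [|T IHT]; first by rewrite !big_geq//= subrr !addr0.
rewrite !big_nat_recr//= IHT.
have := complete_square (state A B u w x0 T) (u T) (v_rec T).
by rewrite /lq_value /lq_excess /lq_drift /=; lra.
Qed.

End CompletionOfSquares.

Lemma state_policy_input (R : realType) n m (A : 'M[R]_n) (B : 'M[R]_(n, m))
    mu w x0 t :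
  state A B (policy_input A B mu w x0) w x0 t = policy_state A B mu w x0 t.
Proof. by elim: t => //= t ->. Qed.

(** * Finite cost forces the state to zero *)

Section FiniteCost.
Variables (R : realType) (n m : nat) (A : 'M[R]_n) (B : 'M[R]_(n, m)).
Variables (Q QT : 'M[R]_n) (Rc : 'M[R]_m).
Hypotheses (hQ : psd Q) (hQT : psd QT) (hRc : pd Rc) (hdet : detectable A Q).
Variables (w : nat -> 'cV[R]_n) (x0 : 'cV[R]_n).
Hypothesis w_cvg0 : enorm (w t) @[t --> \oo] --> 0.
Variable u : nat -> 'cV[R]_m.
Let x := state A B u w x0.

(** Finite cost makes the nonnegative running costs summable, so [Q x_t] and [u_t] vanish;
    detectability passes this on to [x_t]. *)
Lemma finite_cost_cvg : (cost A B Q QT Rc u w x0 < +oo)%E ->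
  enorm (x t) @[t --> \oo] --> 0 /\ cvgn (cost_upto A B Q QT Rc u w x0).
Proof.
pose rc t := qform Q (x t) + qform Rc (u t).
have qx0 t : 0 <= qform Q (x t) by exact: hQ.2.
have qu0 t : 0 <= qform Rc (u t) by exact: (pd_psd hRc).2.
have rc0 t : 0 <= rc t by exact: addr_ge0.
have nd : {homo series rc : a b / (a <= b)%N >-> a <= b}.
  by apply: nondecreasing_series => t _ _.
move=> cost_lty.
have rc_cvg : cvgn (series rc).
  (* The terminal cost is nonnegative, so a divergent running cost would drag [cost_upto] to
     infinity. *)
  apply: contrapT => /(nondecreasing_dvgn_lt nd) rc_dvg.
  move: cost_lty; suff -> : cost A B Q QT Rc u w x0 = +oo%E by rewrite ltxx.
  apply: cvg_lim => //; apply/cvgeryP.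
  apply: (ger_cvgy _ rc_dvg); near=> T.
  by rewrite /cost_upto lerDr hQT.2.
have rc_cvg0 := cvg_series_cvg_0 rc_cvg.
have Qx0 : enorm (Q *m x t) @[t --> \oo] --> 0.
  apply: psd_mulmx_cvg0 => //; apply: squeeze0 rc_cvg0 => // t.
  by rewrite lerDl.
have u0 : enorm (u t) @[t --> \oo] --> 0.
  have Ru0 : enorm (Rc *m u t) @[t --> \oo] --> 0.
    apply: psd_mulmx_cvg0; first exact: pd_psd.
    by apply: squeeze0 rc_cvg0 => // t; rewrite lerDr.
  have := @enorm_mulmx_cvg0 _ _ _ (invmx Rc) _ Ru0.
  by under eq_fun do rewrite mulmxA mulVmx ?pd_unitmx// mul1mx.
have x_cvg0 : enorm (x t) @[t --> \oo] --> 0.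
  have [L AL1] := hdet.
  (* Output injection: adding and subtracting [L Q x_t] gives the stable matrix [A - L Q] with
     vanishing forcing. *)
  apply: (stable_recursion_cvg0 (f := fun t =>
    L *m (Q *m x t) + (B *m u t + w t)) AL1) => [t|].
    by rewrite /x /= mulmxBl -!addrA; congr (_ + _); rewrite mulmxA addKr.
  apply: enormD_cvg0; first exact: enorm_mulmx_cvg0.
  by apply: enormD_cvg0 => //; exact: enorm_mulmx_cvg0.
split=> //; apply: is_cvgD => //.
by apply/cvg_ex; exists 0; exact: qform_cvg0.
Unshelve. all: by end_near. Qed.

End FiniteCost.

(** * The infinite-horizon cost as a limit *)

Section CostLimit.
Variables (R : realType) (n m : nat) (A : 'M[R]_n) (B : 'M[R]_(n, m)).
Variables (Q QT : 'M[R]_n) (Rc : 'M[R]_m) (P : 'M[R]_n).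
Hypotheses (hRc : pd Rc) (hP : psd P).

Let S := input_hessian B Rc P.
Let F := lqr_closed_loop A B Rc P.
Let H := lqr_H B Rc P.

Hypothesis dare : P = Q + A^T *m P *m A
  - A^T *m P *m B *m invmx S *m B^T *m P *m A.

Variables (w v : nat -> 'cV[R]_n) (x0 : 'cV[R]_n) (W V : R).
Hypothesis v_rec : forall t, v t = P *m w t + F^T *m v t.+1.
Hypothesis w_energy : forall T, \sum_(0 <= t < T) enorm (w t) ^+ 2 <= W.
Hypothesis v_energy : forall T, \sum_(0 <= t < T) enorm (v t) ^+ 2 <= V.

Let value := lq_value A B Rc P v.
Let excess := lq_excess A B Rc P w v x0.
Let drift := lq_drift A B Rc P w v.

(** Absolute convergence: each term is dominated by the energies of [w t], [v t] and [v t.+1]. *)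
Lemma drift_cvg : cvgn (series drift).
Proof.
apply: (@normed_cvg _ R^o).
apply: (@bounded_series_cvg _ _ ((spectral_norm P + spectral_norm F) * W +
  spectral_norm F * V + spectral_norm H * V)) => [t|T]; first exact: normr_ge0.
have dot_le t : `|vdot (w t) (F^T *m v t.+1)| * 2 <=
    spectral_norm F * enorm (w t) ^+ 2 + spectral_norm F * enorm (v t.+1) ^+ 2.
  have Fv := enorm_tr_mulmx_le F (v t.+1).
  have := le_trans (vdot_le _ _) (ler_wpM2l (enorm_ge0 (w t)) Fv).
  have := mulr_ge0 (spectral_norm_ge0 F) (sqr_ge0 (enorm (w t) - enorm (v t.+1))).
  rewrite sqrrB; lra.
apply: (@le_trans _ _ (\sum_(0 <= t < T)
   ((spectral_norm P + spectral_norm F) * enorm (w t) ^+ 2 +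
    spectral_norm F * enorm (v t.+1) ^+ 2 +
    spectral_norm H * enorm (v t) ^+ 2))).
  apply: ler_sum => t _.
  have := dot_le t; have := qform_le P (w t); have := qform_le H (v t).
  rewrite /drift /lq_drift -/F -/H.
  have := ler_normB (qform P (w t) + 2 * vdot (w t) (F^T *m v t.+1)) (qform H (v t)).
  have := ler_normD (qform P (w t)) (2 * vdot (w t) (F^T *m v t.+1)).
  rewrite [`|2 * _|]normrM [`|2|]ger0_norm//.
  rewrite /=; lra.
rewrite !big_split/= -!mulr_sumr !lerD// ler_wpM2l//.
- by rewrite addr_ge0 ?spectral_norm_ge0.
- exact: spectral_norm_ge0.
- apply: le_trans (v_energy T.+1); rewrite big_nat_recl//= lerDr.
  exact: sqr_ge0.
- exact: spectral_norm_ge0.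
Qed.

Lemma value_cvg0 (x : nat -> 'cV[R]_n) :
  enorm (x t) @[t --> \oo] --> 0 -> value t (x t) @[t --> \oo] --> 0.
Proof.
move=> x_cvg0; rewrite -[0](addr0 0); apply: cvgD; first exact: qform_cvg0.
rewrite -[0](mulr0 2); apply: cvgMr; apply/norm_cvg0P.
apply: (@squeeze0 _ _ (fun t => enorm (x t) * (spectral_norm F * enorm (v t)))).
- by [].
- move=> t; apply: le_trans (vdot_le _ _) _.
  by apply: ler_wpM2l (enorm_tr_mulmx_le _ _); exact: enorm_ge0.
- rewrite -[0](mul0r (spectral_norm F * 0)); apply: cvgM => //.
  by apply: cvgMr; exact: energy_cvg0 v_energy.
Qed.

Lemma cost_upto_cvg u :
  enorm (state A B u w x0 t) @[t --> \oo] --> 0 -> cvgn (series (excess u)) ->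
  cost_upto A B Q QT Rc u w x0 T @[T --> \oo] -->
    value 0 x0 + limn (series (excess u)) + limn (series drift).
Proof.
move=> x_cvg0 excess_cvg; rewrite -[X in _ --> X]add0r.
apply: cvgD; first exact: qform_cvg0.
under eq_fun do rewrite (running_costE hRc hP dare x0 v_rec).
apply: cvgD drift_cvg; apply: cvgD excess_cvg.
by rewrite -[X in _ --> X]subr0; apply: cvgB (value_cvg0 x_cvg0); exact: cvg_cst.
Qed.

(** Drop the nonnegative excess and terminal cost before the limit; the value at time [T] vanishes
    with the state. *)
Lemma cost_upto_lim_ge (QT_psd : psd QT) u l :
  enorm (state A B u w x0 t) @[t --> \oo] --> 0 ->
  cost_upto A B Q QT Rc u w x0 T @[T --> \oo] --> l ->
  value 0 x0 + limn (series drift) <= l.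
Proof.
move=> x_cvg0 u_cvg.
have lb_cvg : value 0 x0 - value T (state A B u w x0 T) + series drift T
    @[T --> \oo] --> value 0 x0 + limn (series drift).
  apply: cvgD drift_cvg; rewrite -[X in _ --> X]subr0.
  by apply: cvgB (value_cvg0 x_cvg0); exact: cvg_cst.
apply: ler_cvg_to lb_cvg u_cvg _; near=> T.
rewrite /cost_upto (running_costE hRc hP dare x0 v_rec).
have := QT_psd.2 (state A B u w x0 T).
have : 0 <= \sum_(0 <= t < T) excess u t.
  by apply: sumr_ge0 => t _; exact: (pd_psd (pd_input_hessian B hRc hP)).2.
rewrite /series /value /drift /excess /=; lra.
Unshelve. all: by end_near. Qed.

End CostLimit.

(** * Excess and stability of the certainty equivalent input *)

Section CertaintyEquivalence.
Variables (R : realType) (n m : nat) (A : 'M[R]_n) (B : 'M[R]_(n, m)).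
Variables (Rc : 'M[R]_m) (P : 'M[R]_n).
Hypotheses (hRc : pd Rc) (hP : psd P).

Let S := input_hessian B Rc P.
Let F := lqr_closed_loop A B Rc P.
Let H := lqr_H B Rc P.

Variables (w wbar : nat -> 'cV[R]_n) (x0 : 'cV[R]_n).
Let vbar := costate F P wbar.
Let x := state A B (ce_input A B Rc P wbar w x0) w x0.

Lemma ce_inputE t : ce_input A B Rc P wbar w x0 t =
  - (lqr_gain A B Rc P *m x t) - invmx S *m B^T *m vbar t.
Proof. by rewrite /x state_policy_input. Qed.

(** The feedback acts on the true state, so [K x_t] cancels and only [S^-1 B^T (v - vbar)] is
    left. *)
Lemma ce_excess v t : lq_excess A B Rc P w v x0 (ce_input A B Rc P wbar w x0) t =
  qform H (v t - vbar t).
Proof.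
rewrite /lq_excess ce_inputE -/x (qform_lqr_H B hRc hP) mulmxBr; congr qform.
by rewrite [_ - _ + _]addrAC addNr add0r addrC.
Qed.

Lemma ce_state_cvg0 : spectral_radius F < 1 ->
  enorm (w t) @[t --> \oo] --> 0 -> enorm (vbar t) @[t --> \oo] --> 0 ->
  enorm (x t) @[t --> \oo] --> 0.
Proof.
move=> F1 w0 vbar0.
(* The closed loop reads [x_(t+1) = F x_t - H vbar_t + w_t]. *)
apply: (stable_recursion_cvg0 (f := fun t => - H *m vbar t + w t) F1) => [t|].
  rewrite {1}/x /= ce_inputE -/x mulmxBr mulmxN !mulmxA /F /lqr_closed_loop.
  by rewrite mulmxBl mulNmx !addrA /H /lqr_H /lqr_gain !mulmxA.
apply: (@enormD_cvg0 _ _ (fun t => - H *m vbar t)) w0; exact: enorm_mulmx_cvg0.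
Qed.

End CertaintyEquivalence.

(** * Assembly of the regret bound *)

Theorem mainTheorem3 (R : realType) (n m : nat)
    (A : 'M[R]_n) (B : 'M[R]_(n, m)) (Q QT : 'M[R]_n) (Rc : 'M[R]_m)
    (X : R) (x0 : 'cV[R]_n)
    (hX : 0 < X) (hx0 : enorm x0 <= X)
    (hQ : psd Q) (hQT : psd QT) (hRc : pd Rc)
    (hdet : detectable A Q) (hstab : stabilizable A B)
    (P : 'M[R]_n) (hP : stabilizing_dare_solution A B Q Rc P)
    (gammabar : R) (hgamma : 0 < gammabar)
    (hwp : minimax_well_posed A B Q QT Rc gammabar x0)
    (M Lambda : 'M[R]_n)
    (hM : minimal_hinf_solution A B Q Rc gammabar M Lambda)
    (hwstar : l2norm (hinf_disturbance A gammabar M Lambda x0) = 1%E)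
    (w wbar : nat -> 'cV[R]_n) (hw : L2_unit_ball w) (hwbar : L2 wbar)
    (ustar : nat -> 'cV[R]_m)
    (hustar : offline_optimal A B Q QT Rc w x0 ustar)
    (c : R) (hc : 1 < c) :
  let F := lqr_closed_loop A B Rc P in
  let H := lqr_H B Rc P in
  let Finf := hinf_closed_loop A B Rc M Lambda in
  let lambda := (1 + spectral_radius F) / 2 in
  let lambdainf := (1 + spectral_radius Finf) / 2 in
  let uce := ce_input A B Rc P wbar w x0 in
  (forall i : nat, (1 <= i)%N -> spectral_norm (F ^+ i) <= c * lambda ^+ i) ->
  (forall i : nat, (1 <= i)%N ->
    spectral_norm (Finf ^+ i) <= c * lambdainf ^+ i) ->
  [/\ cvgn (cost_upto A B Q QT Rc uce w x0),
      cvgn (cost_upto A B Q QT Rc ustar w x0)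
    & (dynamic_regret A B Q QT Rc uce ustar w x0
       <= l2norm (fun t => w t - wbar t)%R ^+ 2
          * (spectral_norm H * spectral_norm P ^+ 2
             * (c ^+ 2 / (1 - lambda) ^+ 2))%:E)%E].
Proof.
move=> F H Finf lambda lambdainf uce F_decay _.
have [P_psd dare F1] := hP; rewrite -/F in F1.
have lambda01 : 0 <= lambda < 1.
  have F0 := spectral_radius_ge0 F.
  by apply/andP; split; rewrite /lambda; move: F0 F1; lra.
have [W _ wW] := L2_energy (L2_unit_ball_L2 hw).
have [Wbar _ wbarW] := L2_energy hwbar.
(* [energyB] only places [w - wbar] in L2; [D] is then its exact squared norm. *)
have [D l2D dW] := L2_energy (energy_L2 (energyB wW wbarW)).
pose v := costate F P w; pose vbar := costate F P wbar.
have v_energy := costate_energy P hc lambda01 F_decay wW.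
have vbar_energy := costate_energy P hc lambda01 F_decay wbarW.
have v_rec := costate_rec P hc lambda01 F_decay wW.
have w0 := energy_cvg0 wW.
pose bound := D * (spectral_norm H * spectral_norm P ^+ 2 *
  (c ^+ 2 / (1 - lambda) ^+ 2)).
have dv_energy T : \sum_(0 <= t < T) qform H (v t - vbar t) <= bound.
  apply: (@le_trans _ _ (\sum_(0 <= t < T) spectral_norm H *
      enorm (costate F P (fun t => w t - wbar t) t) ^+ 2)).
    apply: ler_sum => t _; rewrite (costateB _ _ hc lambda01 F_decay wW wbarW).
    exact: le_trans (ler_norm _) (qform_le _ _).
  rewrite -mulr_sumr.
  have -> : bound = spectral_norm H *
      (D * (spectral_norm P ^+ 2 * (c ^+ 2 / (1 - lambda) ^+ 2))).
    by rewrite /bound; ring.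
  rewrite ler_wpM2l ?spectral_norm_ge0//.
  exact: (costate_energy P hc lambda01 F_decay dW).
have qH0 y : 0 <= qform H y.
  rewrite (qform_lqr_H B hRc P_psd).
  exact: (pd_psd (pd_input_hessian B hRc P_psd)).2.
(* The cost of zero excess: a lower bound for [ustar], attained by [u0] below. *)
pose J0 := lq_value A B Rc P v 0 x0 + limn (series (lq_drift A B Rc P w v)).
have uce_excess : lq_excess A B Rc P w v x0 uce = fun t => qform H (v t - vbar t).
  by apply/funext => t; exact: ce_excess.
have regret_cvg : cvgn (series (lq_excess A B Rc P w v x0 uce)).
  by rewrite uce_excess; apply: bounded_series_cvg dv_energy.
have regret_le : limn (series (lq_excess A B Rc P w v x0 uce)) <= bound.
  apply: (cvgr_to_le regret_cvg); near=> T.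
  by rewrite uce_excess; exact: dv_energy.
have ce_state_cvg0 z Z : (forall T, \sum_(0 <= t < T) enorm (z t) ^+ 2 <= Z) ->
    enorm (state A B (ce_input A B Rc P z w x0) w x0 t) @[t --> \oo] --> 0.
  move=> zZ; apply: ce_state_cvg0 => //.
  exact: energy_cvg0 (costate_energy P hc lambda01 F_decay zZ).
have uce_cvg := cost_upto_cvg QT hRc P_psd dare v_rec wW v_energy
  (ce_state_cvg0 _ _ wbarW) regret_cvg.
(* With the exact prediction the excess is zero and the cost is the finite [J0]. Compared with [u0],
   the optimal [ustar] has finite cost, hence a vanishing state. *)
pose u0 := ce_input A B Rc P w w x0.
have u0_excess : series (lq_excess A B Rc P w v x0 u0) = fun=> 0.
  apply/funext => T; rewrite /series/= big1// => t _.
  by rewrite ce_excess// subrr /qform mulmx0 mxE.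
have u0_cvg : cost_upto A B Q QT Rc u0 w x0 T @[T --> \oo] --> J0.
  have u0_excess_cvg : cvgn (series (lq_excess A B Rc P w v x0 u0)).
    by rewrite u0_excess; exact: is_cvg_cst.
  have := cost_upto_cvg QT hRc P_psd dare v_rec wW v_energy
    (ce_state_cvg0 _ _ wW) u0_excess_cvg.
  by rewrite u0_excess lim_cst// addr0.
have cost_cvg u l : cost_upto A B Q QT Rc u w x0 T @[T --> \oo] --> l ->
    cost A B Q QT Rc u w x0 = l%:E.
  by move=> ul; apply: cvg_lim => //; apply: cvg_EFin => //; near=> T.
have ustar_lty : (cost A B Q QT Rc ustar w x0 < +oo)%E.
  by apply: le_lt_trans (hustar u0) _; rewrite (cost_cvg _ _ u0_cvg) ltry.
have [xstar0 ustar_cvg] := finite_cost_cvg hQ hQT hRc hdet w0 ustar_lty.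
have J0_le := cost_upto_lim_ge hRc P_psd dare v_rec wW v_energy hQT xstar0 ustar_cvg.
split=> //; first by apply/cvg_ex; eexists; exact: uce_cvg.
(* The first cost is [J0] plus the total excess of [uce], and the second is at least [J0]. *)
rewrite /dynamic_regret (cost_cvg _ _ uce_cvg) (cost_cvg _ _ ustar_cvg) l2D.
rewrite -EFinB -EFinM lee_fin -/bound; move: J0_le regret_le; lra.
Unshelve. all: by end_near. Qed.
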